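(* Let $\Omega>0$, $\sigma>0$, let $T_\Omega$ be a distribution in $\mathcal{H}_\Omega$, and let $\hat T^\Omega_\Phi$ be its distributional Fourier transform, associated to $\Phi\in L^2(S^1)$. Then, considering the extension of $\mathcal{B}^{\mathbb{H}^2}_\sigma$ to tempered distributions, $$\mathcal{B}^{\mathbb{H}^2}_\sigma T_\Omega(q,p)=e^{-\frac{\sigma^2\Omega^2}{2}}\,\frac{\sqrt{j_0(-2i\sigma^2|p|\Omega)}}{\sigma\sqrt{\pi}}\;\mathcal{B}^{\sigma^2|p|}_\Omega\Phi(q,\theta),$$ where $p=|p|(\cos\theta,\sin\theta)$.
   Context: $S^1=\mathbb{R}/2\pi\mathbb{Z}$ carries the measure $d\varphi$ of total mass $2\pi$. Fourier transform on $\mathbb{R}^2$: $\mathcal{F}f(k)=\frac1{2\pi}\int_{\mathbb{R}^2}e^{-ik\cdot x}f(x)\,dx$, extended to tempered distributions. The pairing $\langle T,\psi\rangle_{\mathcal{S}'\,\mathcal{S}}$ is linear in $T$ and antilinear in $\psi$ (a function $f$ acts by $\psi\mapsto\int f\overline\psi$), and $\langle\mathcal{F}^{-1}T,\psi\rangle_{\mathcal{S}'\,\mathcal{S}}=\langle T,\mathcal{F}\psi\rangle_{\mathcal{S}'\,\mathcal{S}}$. For $u\in L^2(S^1)$, $\hat T^\Omega_u\in\mathcal{S}'(\mathbb{R}^2)$ is defined by $\langle\hat T^\Omega_u,\psi\rangle_{\mathcal{S}'\,\mathcal{S}}=\int_0^{2\pi}u(\varphi)\overline{\psi(\Omega\cos\varphi,\Omega\sin\varphi)}\,d\varphi$,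 and $\mathcal{H}_\Omega=\{\mathcal{F}^{-1}\hat T^\Omega_u:u\in L^2(S^1)\}$. $j_0(s)=\int_0^{2\pi}e^{is\cos\varphi}\,d\varphi$ for $s\in\mathbb{C}$. The $SE(2)$-Bargmann transform with parameters $\Omega>0$, $\lambda\in\mathbb{R}$ is, for $\Phi\in L^2(S^1)$, $q\in\mathbb{R}^2$, $\theta\in S^1$, $$\mathcal{B}^\lambda_\Omega\Phi(q,\theta)=\langle\Pi^\Omega(q,\theta)u^{\lambda,\Omega},\Phi\rangle_{L^2(S^1)}=\int_0^{2\pi}\overline{\Pi^\Omega(q,\theta)u^{\lambda,\Omega}(\varphi)}\,\Phi(\varphi)\,d\varphi,$$ where $\Pi^\Omega(q,\theta)u(\varphi)=e^{-i\Omega(q_1\cos\varphi+q_2\sin\varphi)}u(\varphi-\theta)$ and $u^{\lambda,\Omega}(\varphi)=\frac{1}{\sqrt{j_0(-2i\lambda\Omega)}}e^{\lambda\Omega\cos\varphi}$. The ordinary Bargmann transform is, for $f\in L^2(\mathbb{R}^2)$ and $q,p\in\mathbb{R}^2$, $$\mathcal{B}^{\mathbb{H}^2}_\sigma f(q,p)=e^{\frac{\sigma^2|p|^2}{2}}\int_{\mathbb{R}^2}\overline{g_{q,p}(x)}\,f(x)\,dx,\qquad g_{q,p}(x)=e^{ip\cdot(x-q)}g_0(x-q),\quad g_0(x)=\frac{1}{\sigma\sqrt\pi}e^{-\frac{|x|^2}{2\sigma^2}},$$ and it is extended to $T\in\mathcal{S}'(\mathbb{R}^2)$ by $\mathcal{B}^{\mathbb{H}^2}_\sigma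 T(q,p)=e^{\frac{\sigma^2|p|^2}{2}}\langle T,g_{q,p}\rangle_{\mathcal{S}'\,\mathcal{S}}$.
   Formalization: The printed factor 1/(σ√π) is corrected to σ/√π: with the stated conventions the printed identity fails for every σ≠1 (take Φ=1, p=q=0: left side 2√π·σ·e^{-σ²Ω²/2}, printed right side 2√π·σ^{-1}·e^{-σ²Ω²/2}). *)

(* Defs.v *)
From HB Require Import structures.
From mathcomp Require Import all_boot all_order all_algebra.
From mathcomp Require Import complex.
From mathcomp Require Import all_classical all_reals all_analysis.
Set Implicit Arguments.
Unset Strict Implicit.
Unset Printing Implicit Defensive.
Import Order.TTheory GRing.Theory Num.Theory.
Import numFieldNormedType.Exports.
Local Open Scope classical_set_scope.
Local Open Scope ring_scope.
Local Open Scope complex_scope.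

Definition cexp (R : realType) (z : R[i]) : R[i] :=
  (expR (complex.Re z))%:C * (cos (complex.Im z) +i* sin (complex.Im z)).

Definition cmeasurable d (T : measurableType d) (R : realType)
    (f : T -> R[i]) : Prop :=
  measurable_fun setT (fun x => complex.Re (f x)) /\
  measurable_fun setT (fun x => complex.Im (f x)).

Definition cintegral d (T : measurableType d) (R : realType)
    (mu : {measure set T -> \bar R}) (D : set T) (f : T -> R[i]) : R[i] :=
  Rintegral mu D (fun x => complex.Re (f x)) +i*
  Rintegral mu D (fun x => complex.Im (f x)).

(* S^1 = R / 2 pi Z is handled through 2pi-periodic functions on R, integrated
   over [0, 2 pi]; the plane is R * R.  Note that the library norm on R * R is
   the sup norm, hence the Euclidean norm [enorm]. *)
Definition intS1 (R : realType) (f : R -> R[i]) : R[i] :=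
  cintegral lebesgue_measure `[0, pi *+ 2] f.

Definition intR2 (R : realType) (f : R * R -> R[i]) : R[i] :=
  cintegral (lebesgue_measure \x lebesgue_measure)%E setT f.

Definition dot (R : realType) (x y : R * R) : R := x.1 * y.1 + x.2 * y.2.

Definition enorm (R : realType) (x : R * R) : R := Num.sqrt (dot x x).

Definition polar (R : realType) (r t : R) : R * R := (r * cos t, r * sin t).

Definition L2S1 (R : realType) (u : R -> R[i]) : Prop :=
  [/\ periodic u (pi *+ 2), cmeasurable u &
      (\int[lebesgue_measure]_(t in `[0%R, (pi *+ 2)%R])
         ((Normc.normc (u t)) ^+ 2)%:E < +oo)%E].

Definition dotS1 (R : realType) (u v : R -> R[i]) : R[i] :=
  intS1 (fun t => (u t)^*%C * v t).

Definition axis (R : realType) (b : bool) : R * R :=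
  if b then (0, 1) else (1, 0).

(* Iterated partial derivative along a word of coordinate directions
   (false = first coordinate, true = second); the head is applied last. *)
Definition pderiv (R : realType) (w : seq bool) (f : R * R -> R) :
    R * R -> R :=
  foldr (fun b g x => 'D_(axis R b) g x) f w.

Definition cpderiv (R : realType) (w : seq bool) (f : R * R -> R[i]) :
    R * R -> R[i] :=
  fun x => pderiv w (fun y => complex.Re (f y)) x +i*
           pderiv w (fun y => complex.Im (f y)) x.

Definition seminorm_fun (R : realType) (a b : nat) (w : seq bool)
    (f : R * R -> R[i]) (x : R * R) : R :=
  `|x.1 ^+ a * x.2 ^+ b| * Normc.normc (cpderiv w f x).

Definition seminorm (R : realType) (a b : nat) (w : seq bool)
    (f : R * R -> R[i]) : R :=
  sup (range (seminorm_fun a b w f)).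

(* Existence of all mixed partial derivatives, together with the boundedness of
   each of them, makes each of them Lipschitz, so f is indeed C^oo. *)
Definition schwartz (R : realType) (f : R * R -> R[i]) : Prop :=
  (forall (w : seq bool) (b : bool) (x : R * R),
     derivable (pderiv w (fun y => complex.Re (f y))) x (axis R b) /\
     derivable (pderiv w (fun y => complex.Im (f y))) x (axis R b)) /\
  (forall (a b : nat) (w : seq bool),
     has_ubound (range (seminorm_fun a b w f))).

(* A distribution is an antilinear functional <T, _>.  As a Rocq function it is
   total, but only its values on Schwartz functions are meaningful:
   [tempered] and [eqD] only look at these. *)
Definition distr (R : realType) : Type := (R * R -> R[i]) -> R[i].

Definition tempered (R : realType) (T : distr R) : Prop :=
  (forall (c : R[i]) (f g : R * R -> R[i]), schwartz f -> schwartz g ->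
     T (fun x => c * f x + g x) = c^*%C * T f + T g) /\
  exists (N : nat) (C : R), forall f : R * R -> R[i], schwartz f ->
    Normc.normc (T f) <=
    C * \sum_(a < N.+1) \sum_(b < N.+1) \sum_(c < N.+1) \sum_(d < N.+1)
          seminorm a b (nseq c false ++ nseq d true) f.

Definition eqD (R : realType) (S T : distr R) : Prop :=
  forall f : R * R -> R[i], schwartz f -> S f = T f.

Definition fourier (R : realType) (f : R * R -> R[i]) (k : R * R) : R[i] :=
  ((pi *+ 2)^-1)%:C * intR2 (fun x => cexp (- 'i%C * (dot k x)%:C) * f x).

Definition inv_fourier (R : realType) (f : R * R -> R[i]) (x : R * R) : R[i] :=
  ((pi *+ 2)^-1)%:C * intR2 (fun k => cexp ('i%C * (dot k x)%:C) * f k).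

(* With a pairing that is antilinear on the right, the extension of the
   (unitary) Fourier transform is <F T, f> = <T, F^-1 f>. *)
Definition fourierD (R : realType) (T : distr R) : distr R :=
  fun f => T (inv_fourier f).

Definition inv_fourierD (R : realType) (T : distr R) : distr R :=
  fun f => T (fourier f).

Definition That (R : realType) (Omega : R) (u : R -> R[i]) : distr R :=
  fun f => intS1 (fun t => u t * (f (polar Omega t))^*%C).

Definition HOmega (R : realType) (Omega : R) : set (distr R) :=
  [set T | tempered T /\
     exists2 u : R -> R[i], L2S1 u & eqD T (inv_fourierD (That Omega u))].

Definition j0 (R : realType) (s : R[i]) : R[i] :=
  intS1 (fun t => cexp ('i%C * s * (cos t)%:C)).

Definition PiSE2 (R : realType) (Omega : R) (q : R * R) (theta : R)
    (u : R -> R[i]) : R -> R[i] :=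
  fun t => cexp (- 'i%C * (Omega * (q.1 * cos t + q.2 * sin t))%:C)
           * u (t - theta).

Definition u0 (R : realType) (lambda Omega : R) : R -> R[i] :=
  fun t => (sqrtC (j0 (- 2 * 'i%C * (lambda * Omega)%:C)))^-1
           * (expR (lambda * Omega * cos t))%:C.

Definition bargmannSE2 (R : realType) (lambda Omega : R) (Phi : R -> R[i])
    (q : R * R) (theta : R) : R[i] :=
  dotS1 (PiSE2 Omega q theta (u0 lambda Omega)) Phi.

Definition gauss (R : realType) (sigma : R) (x : R * R) : R :=
  (sigma * Num.sqrt pi)^-1 * expR (- (enorm x ^+ 2 / (2 * sigma ^+ 2))).

(* With the unitary Fourier transform on the plane,
     fourier (gauss sigma) k = sigma / sqrt pi * exp (- sigma^2 |k|^2 / 2):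
   the Jacobian sigma^2 turns the factor 1 / (sigma sqrt pi) of [gauss] into
   sigma / sqrt pi. *)
Definition coherent (R : realType) (sigma : R) (q p x : R * R) : R[i] :=
  cexp ('i%C * (dot p (x - q))%:C) * (gauss sigma (x - q))%:C.

Definition bargmannH2 (R : realType) (sigma : R) (f : R * R -> R[i])
    (q p : R * R) : R[i] :=
  (expR (sigma ^+ 2 * enorm p ^+ 2 / 2))%:C
  * intR2 (fun x => (coherent sigma q p x)^*%C * f x).

Definition bargmannH2D (R : realType) (sigma : R) (T : distr R)
    (q p : R * R) : R[i] :=
  (expR (sigma ^+ 2 * enorm p ^+ 2 / 2))%:C * T (coherent sigma q p).

(* Main.v *)
Require Import Defs.
From HB Require Import structures.
From mathcomp Require Import all_boot all_order all_algebra.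
From mathcomp Require Import complex.
From mathcomp Require Import all_classical all_reals all_analysis.
From mathcomp Require Import measurable_realfun.
From mathcomp Require Import ring lra.
Import Order.TTheory GRing.Theory Num.Theory.
Import numFieldNormedType.Exports.
Local Open Scope classical_set_scope.
Local Open Scope ring_scope.
Local Open Scope complex_scope.

(** A coherent state is the inverse Fourier transform of a Gaussian that is
    modulated by a plane wave: [coherent sigma q p] is [inv_fourier] of
      [k |-> sigma / sqrt pi * exp (- sigma^2 |k - p|^2 / 2) * exp (- i k.q)]
    ([inv_fourier_gauss_plane]).  This [k]-space function is a Schwartz function
    ([schwartz_gauss_plane]), so pairing [T] with the coherent state is the same
    as pairing the Fourier transform of [T] with it, that is, integrating it
    against [Phi] over the circle of radius [Omega].

    On that circle [|k|^2 = Omega^2], and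
    [k.p = Omega |p| cos (phi - theta)] as [p] has argument [theta], hence
      [exp (- sigma^2 |k - p|^2 / 2) = exp (- sigma^2 (Omega^2 + |p|^2) / 2)
                                  * exp (sigma^2 |p| Omega cos (phi - theta))].
    The last factor is the rotated minimal-uncertainty state of SE(2) with
    [lambda = sigma^2 |p|], up to its normalization [1 / sqrt j0], and the
    plane wave is the translation by [q].  The factor [exp (sigma^2 |p|^2 / 2)]
    of the Bargmann transform cancels the term in [|p|^2].

    The analytic core is the Fourier integral of a one-dimensional Gaussian
    ([Rintegral_gauss_wave0]), proved with the differential equation that it
    satisfies in the frequency; Fubini ([Rintegral_prodM]) carries it to the
    plane.  Boundedness, integrability and smoothness all come from one class of
    functions, the combinations of [(x - m)^a exp (- c (x - m)^2) cos (..)],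
    which is stable under differentiation and multiplication by [x]. *)

Set Implicit Arguments.
Unset Strict Implicit.
Unset Printing Implicit Defensive.

(** * One-dimensional Gaussian wave packets *)

Section gauss_trig.
Context {R : realType}.
Implicit Types (c m w b x : R) (f g : R -> R).

(** The phase [b] makes a single family contain both cosine and sine: a
    derivative shifts it by [pi / 2].  Centring the monomial and the phase at
    [m] leaves the Gaussian integrals independent of [m]. *)
Definition gauss_wave c m a w b x : R :=
  (x - m) ^+ a * expR (- (c * (x - m) ^+ 2)) * cos (w * (x - m) + b).

Inductive gauss_trig c m : (R -> R) -> Prop :=
| gauss_trig_wave a w b : gauss_trig c m (gauss_wave c m a w b)
| gauss_trigD f g : gauss_trig c m f -> gauss_trig c m g ->
    gauss_trig c m (fun x => f x + g x)
| gauss_trigZ k f : gauss_trig c m f -> gauss_trig c m (fun x => k * f x).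

Lemma is_derive_gauss_wave c m a w b x :
  is_derive x 1 (gauss_wave c m a w b)
    (a%:R * gauss_wave c m a.-1 w b x + ((- (2 * c)) * gauss_wave c m a.+1 w b x
     + w * gauss_wave c m a w (b + pi / 2) x)).
Proof.
have dm : is_derive x 1 (fun y : R => y - m) 1.
  by apply: is_derive_eq; rewrite subr0.
have dX : is_derive x 1 (fun y : R => (y - m) ^+ a) (a%:R * (x - m) ^+ a.-1).
  rewrite -[X in is_derive _ _ _ X]mulr1.
  apply: (@is_derive1_comp _ (fun z => z ^+ a)).
  by apply: DeriveDef; rewrite ?exp_derive ?scaler1//; exact: exprn_derivable.
have dE : is_derive x 1 (fun y : R => expR (- (c * (y - m) ^+ 2)))
    (expR (- (c * (x - m) ^+ 2)) * (- (c * (2 * (x - m))))).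
  apply: (@is_derive1_comp _ expR (fun y : R => - (c * (y - m) ^+ 2))).
  by apply: is_derive_eq; rewrite /GRing.scale /=; ring.
have dC : is_derive x 1 (fun y : R => cos (w * (y - m) + b))
    (- sin (w * (x - m) + b) * w).
  apply: (@is_derive1_comp _ cos (fun y : R => w * (y - m) + b)).
  by apply: is_derive_eq; rewrite /GRing.scale /=; ring.
rewrite /gauss_wave (addrA _ b) cosDpihalf.
apply: (is_derive_eq (is_deriveM (is_deriveM dX dE) dC)).
by rewrite /GRing.scale /= [in LHS]fctE (exprS _ a); ring.
Qed.

Lemma gauss_trig_derive c m f : gauss_trig c m f ->
  exists2 df, gauss_trig c m df & forall x, is_derive x 1 f (df x).
Proof.
elim=> [a w b|{}f g _ [df tf fE] _ [dg tg gE]|k {}f _ [df tf fE]].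
- eexists; last by move=> x; exact: is_derive_gauss_wave.
  by do !(apply: gauss_trigD || apply: gauss_trigZ || apply: gauss_trig_wave).
- exists (fun x => df x + dg x); first exact: gauss_trigD.
  by move=> x; apply: is_deriveD.
- exists (fun x => k * df x); first exact: gauss_trigZ.
  by move=> x; apply: is_deriveZ.
Qed.

Lemma gauss_trigMx c m f : gauss_trig c m f ->
  gauss_trig c m (fun x => x * f x).
Proof.
elim=> [a w b|{}f g _ tf _ tg|k {}f _ tf].
- rewrite (_ : (fun x => _) = fun x =>
    gauss_wave c m a.+1 w b x + m * gauss_wave c m a w b x); last first.
    by apply/funext => x; rewrite /gauss_wave (exprS _ a); ring.
  by apply: gauss_trigD; [|apply: gauss_trigZ]; exact: gauss_trig_wave.
- under eq_fun do rewrite mulrDr; exact: gauss_trigD.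
- under eq_fun do rewrite mulrCA; exact: gauss_trigZ.
Qed.

Lemma gauss_trigMXn c m n f : gauss_trig c m f ->
  gauss_trig c m (fun x => x ^+ n * f x).
Proof.
elim: n f => [|n IHn] f tf; first by under eq_fun do rewrite mul1r.
by under eq_fun do rewrite exprSr -mulrA; exact/IHn/gauss_trigMx.
Qed.

(** Half of the Gaussian absorbs any power of [t]: from [|t| <= exp |t|] one
    gets [|t|^n <= exp (n |t|)], and completing the square bounds
    [n |t| - c t^2 / 2] by [n^2 / (2 c)]. *)
Lemma pow_expR_le c n t : 0 < c ->
  `|t| ^+ n * expR (- (c * t ^+ 2)) <=
  expR (n%:R ^+ 2 / (2 * c)) * expR (- (c / 2 * t ^+ 2)).
Proof.
move=> c0; apply: (@le_trans _ _ (expR (n%:R * `|t|) * expR (- (c * t ^+ 2)))).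
  rewrite ler_wpM2r ?expR_ge0// expRM_natl lerXn2r ?nnegrE ?expR_ge0//.
  by rewrite (le_trans _ (expR_ge1Dx _))// lerDr ler01.
rewrite -!expRD ler_expR -(real_normK (num_real t)).
set s := `|t|; rewrite -subr_ge0.
have -> : n%:R ^+ 2 / (2 * c) - c / 2 * s ^+ 2 - (n%:R * s - c * s ^+ 2)
   = (2 * c)^-1 * (c * s - n%:R) ^+ 2 :> R by field; rewrite lt0r_neq0.
by rewrite mulr_ge0 ?sqr_ge0// invr_ge0 mulr_ge0// ltW.
Qed.

(** A Gaussian majorant, half as steep; it yields both boundedness and
    integrability. *)
Lemma gauss_trig_le c m f : 0 < c -> gauss_trig c m f ->
  exists2 M, 0 <= M & forall x, `|f x| <= M * expR (- (c / 2 * (x - m) ^+ 2)).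
Proof.
move=> c0; elim=> [a w b|{}f g _ [M M0 fM] _ [N N0 gN]|k {}f _ [M M0 fM]].
- exists (expR (a%:R ^+ 2 / (2 * c))); first exact: expR_ge0.
  move=> x; apply: le_trans (pow_expR_le a (x - m) c0).
  rewrite /gauss_wave normrM normrM normrX (ger0_norm (expR_ge0 _)).
  by rewrite ler_piMr ?cos_max// mulr_ge0 ?expR_ge0// exprn_ge0.
- exists (M + N); first exact: addr_ge0.
  by move=> x; rewrite mulrDl (le_trans (ler_normD _ _))// lerD.
- exists (`|k| * M); first exact: mulr_ge0.
  by move=> x; rewrite normrM -(mulrA _ M) ler_wpM2l.
Qed.

Lemma gauss_trig_bounded c m f : 0 < c -> gauss_trig c m f ->
  exists M, forall x, `|f x| <= M.
Proof.
move=> c0 /(gauss_trig_le c0)[M M0 fM]; exists M => x.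
rewrite (le_trans (fM x))// ler_piMr// -[leRHS]expR0 ler_expR oppr_le0.
by rewrite mulr_ge0 ?sqr_ge0// divr_ge0// ltW.
Qed.

Lemma gauss_trig_continuous c m f : gauss_trig c m f -> continuous f.
Proof.
move=> /gauss_trig_derive[df _ fE] x.
apply/differentiable_continuous/derivable1_diffP.
by have [] := fE x.
Qed.

Lemma gauss_trig_measurable c m f : gauss_trig c m f -> measurable_fun setT f.
Proof. by move=> /gauss_trig_continuous; exact: continuous_measurable_fun. Qed.

Lemma gauss_trig_gauss c m :
  gauss_trig c m (fun x => expR (- (c * (x - m) ^+ 2))).
Proof.
rewrite (_ : (fun x => _) = gauss_wave c m 0 0 0); first exact: gauss_trig_wave.
by apply/funext => x; rewrite /gauss_wave expr0 mul0r addr0 cos0 mul1r mulr1.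
Qed.

Notation mu := (@lebesgue_measure R).

Lemma normal_funE c m : 0 < c ->
  normal_fun m (Num.sqrt (2 * c)^-1) = fun x => expR (- (c * (x - m) ^+ 2)).
Proof.
move=> c0; apply/funext => x; rewrite /normal_fun sqr_sqrtr; last first.
  by rewrite invr_ge0 mulr_ge0// ltW.
by congr expR; rewrite -mulr_natr; field; rewrite lt0r_neq0.
Qed.

Lemma integral_gauss c m : 0 < c ->
  (\int[mu]_x (expR (- (c * (x - m) ^+ 2)))%:E = (Num.sqrt (pi / c))%:E)%E.
Proof.
move=> c0; set s := Num.sqrt (2 * c)^-1.
have s2 : s ^+ 2 = (2 * c)^-1 by rewrite sqr_sqrtr// invr_ge0 mulr_ge0// ltW.
have s0 : s != 0 by rewrite gt_eqF// sqrtr_gt0 invr_gt0 mulr_gt0.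
have := integral_normal_pdf m s; rewrite normal_pdfE//.
rewrite /normal_peak (_ : s ^+ 2 * pi *+ 2 = pi / c); last first.
  by rewrite s2 -mulr_natr; field; rewrite lt0r_neq0.
have p0 : 0 < Num.sqrt (pi / c) by rewrite sqrtr_gt0 divr_gt0// pi_gt0.
under eq_integral do rewrite EFinM /s normal_funE//.
rewrite ge0_integralZl//=; last first.
  apply/measurable_EFinP.
  exact: gauss_trig_measurable (gauss_trig_gauss c m).
move=> /(congr1 (fun z => (Num.sqrt (pi / c))%:E * z)%E).
by rewrite muleA -EFinM mulfV ?lt0r_neq0// mul1e mule1.
Qed.

Lemma integrable_gauss c m : 0 < c ->
  mu.-integrable setT (EFin \o (fun x => expR (- (c * (x - m) ^+ 2)))).
Proof.
move=> c0; apply/integrableP; split.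
  apply/measurable_EFinP.
  exact: gauss_trig_measurable (gauss_trig_gauss c m).
under eq_integral do rewrite /= ger0_norm ?expR_ge0//.
by rewrite integral_gauss// ltry.
Qed.

Lemma gauss_trig_integrable c m f : 0 < c -> gauss_trig c m f ->
  mu.-integrable setT (EFin \o f).
Proof.
move=> c0 tf; have [M M0 fM] := gauss_trig_le c0 tf.
have c20 : 0 < c / 2 by rewrite divr_gt0.
apply: le_integrable
  (integrableZl measurableT M (integrable_gauss m c20)) => //.
  by apply/measurable_EFinP; exact: gauss_trig_measurable tf.
move=> x _ /=; rewrite lee_fin (le_trans (fM x))//.
by rewrite ger0_norm// mulr_ge0 ?expR_ge0.
Qed.

(** Integration by parts on the whole line without boundary terms: the integral
    over [[-n, n]] is [h n - h (- n)], at most [2 M / n] in absolute value, and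
    it converges to the full integral by dominated convergence. *)
Lemma Rintegral_derive_eq0 (h dh : R -> R) (M : R) :
  (forall x, is_derive x 1 h (dh x)) -> continuous dh ->
  mu.-integrable setT (EFin \o dh) -> (forall x, `|x * h x| <= M) ->
  \int[mu]_x dh x = 0.
Proof.
move=> hE cdh idh hM.
have mdh : measurable_fun setT dh by exact: continuous_measurable_fun.
pose I n := `[- n.+1%:R : R, n.+1%:R]%classic.
have [|||||_ _ /= cvgI] := @dominated_convergence _ _ _ mu _ measurableT
    (fun n => EFin \o (dh \_ (I n))) (EFin \o dh) (EFin \o (Num.norm \o dh)).
- move=> n; apply/measurable_EFinP; apply/(measurable_restrictT _ _).1.
    exact: measurable_itv.
  exact: measurable_funTS.
- exact/measurable_EFinP.
- apply: aeW => x _; apply: cvg_near_cst.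
  near=> n; rewrite /= patchE mem_set// /I /= in_itv/= -ler_norml.
  rewrite (@le_trans _ _ n%:R) ?ler_nat//.
  by near: n; exact: nbhs_infty_ger.
- exact: integrable_norm.
- apply: aeW => x n _ /=; rewrite lee_fin patchE.
  by case: ifPn => // _; rewrite normr0.
have FTC n : (\int[mu]_x ((dh \_ (I n)) x)%:E =
    (h n.+1%:R - h (- n.+1%:R))%:E)%E.
  rewrite -[LHS]/(\int[mu]_x (EFin \o (dh \_ (I n))) x)%E -restrict_EFin.
  rewrite -integral_mkcond EFinB.
  apply: continuous_FTC2.
  - by rewrite gtrN.
  - exact: continuous_subspaceT.
  - have ch : continuous h.
      move=> x; apply/differentiable_continuous/derivable1_diffP.
      by have [] := hE x.
    split; [by move=> x _; have [] := hE x|exact/cvg_at_right_filter/ch|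
            exact/cvg_at_left_filter/ch].
  - by move=> x _; rewrite derive1E; have [_ ->] := hE x.
have cvg0 : (h n.+1%:R - h (- n.+1%:R))%:E @[n --> \oo] --> 0%:E.
  apply: cvg_EFin; first exact: nearW.
  apply: norm_cvg0.
  apply: (@squeeze_cvgr _ _ _ _ (cst 0) (fun n => 2 * M * n.+1%:R^-1)).
  - apply: nearW => n; rewrite normr_ge0/= ler_pdivlMr//.
    have := hM n.+1%:R; have := hM (- n.+1%:R).
    rewrite !normrM normrN (ger0_norm (ler0n _ _)) => h1 h2.
    rewrite mulrC (le_trans (ler_wpM2l (ler0n _ _) (ler_normB _ _)))//.
    by rewrite mulrDr (mulr_natl M 2) mulr2n lerD.
  - exact: cvg_cst.
  - rewrite -(mulr0 (2 * M)); apply: cvgMr; exact: cvg_harmonic.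
rewrite /Rintegral -(cvg_lim _ cvgI)//.
under eq_fun do rewrite FTC.
by rewrite (cvg_lim _ cvg0).
Unshelve. all: by end_near. Qed.

End gauss_trig.

(** * The Fourier integral of a Gaussian *)

Section gauss_fourier.
Context {R : realType}.
Notation mu := (@lebesgue_measure R).

Lemma gauss_wave_phase_pi (c m : R) a w b t :
  gauss_wave c m a w (b + pi / 2 + pi / 2) t = - gauss_wave c m a w b t.
Proof.
rewrite /gauss_wave (addrA _ _ (pi / 2)) cosDpihalf (addrA _ b) sinDpihalf.
by rewrite mulrN.
Qed.

(** The derivative of [exp (- c (t - m)^2) cos (w (t - m) + b + pi / 2)] has
    integral zero; it combines the two integrands below. *)
Lemma Rintegral_gauss_wave1 (c m w b : R) : 0 < c ->
  \int[mu]_t gauss_wave c m 1 w (b + pi / 2) t =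
  - (w / (2 * c)) * \int[mu]_t gauss_wave c m 0 w b t.
Proof.
move=> c0; set b' := b + pi / 2.
have iW a b1 : mu.-integrable setT (EFin \o gauss_wave c m a w b1).
  by apply: (gauss_trig_integrable c0); exact: gauss_trig_wave.
pose dh (t : R) : R :=
  - (2 * c) * gauss_wave c m 1 w b' t - w * gauss_wave c m 0 w b t.
have tdh : gauss_trig c m dh.
  apply: gauss_trigD; first by apply: gauss_trigZ; exact: gauss_trig_wave.
  under eq_fun do rewrite -mulNr.
  by apply: gauss_trigZ; exact: gauss_trig_wave.
have hE (t : R) : is_derive t 1 (gauss_wave c m 0 w b') (dh t).
  apply: (is_derive_eq (is_derive_gauss_wave c m 0 w b' t)).
  by rewrite /dh mul0r add0r gauss_wave_phase_pi mulrN.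
have [M hM] := gauss_trig_bounded c0
  (gauss_trigMx (gauss_trig_wave c m 0 w b')).
have := Rintegral_derive_eq0 hE (gauss_trig_continuous tdh)
  (gauss_trig_integrable c0 tdh) hM.
rewrite /dh RintegralB//; last 2 first.
- exact: (integrableZl measurableT (- (2 * c)) (iW _ _)).
- exact: (integrableZl measurableT w (iW _ _)).
rewrite RintegralZl// RintegralZl// => /eqP.
rewrite subr_eq0 => /eqP /(congr1 (fun z => - (2 * c)^-1 * z)).
by rewrite mulrA mulrNN mulVf ?mul1r ?mulf_neq0 ?lt0r_neq0// => ->; ring.
Qed.

(** Differentiation under the integral sign; the frequency derivative is
    dominated by [|t - m| exp (- c (t - m)^2)] at every frequency. *)
Lemma is_derive_Rintegral_gauss_wave (c m b w : R) : 0 < c ->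
  is_derive w 1 (fun w => \int[mu]_t gauss_wave c m 0 w b t)
    (\int[mu]_t gauss_wave c m 1 w (b + pi / 2) t).
Proof.
move=> c0; pose f (w t : R) : R := gauss_wave c m 0 w b t.
have iW a w1 b1 : mu.-integrable setT (EFin \o gauss_wave c m a w1 b1).
  by apply: (gauss_trig_integrable c0); exact: gauss_trig_wave.
have df (w1 t : R) :
    is_derive w1 1 (f ^~ t) (gauss_wave c m 1 w1 (b + pi / 2) t).
  rewrite /f /gauss_wave.
  have dC : is_derive w1 1 (fun w : R => cos (w * (t - m) + b))
      (- sin (w1 * (t - m) + b) * (t - m)).
    apply: (@is_derive1_comp _ cos (fun w : R => w * (t - m) + b)).
    by apply: is_derive_eq; rewrite /GRing.scale /=; ring.
  apply: (is_derive_eq (is_deriveZ _ dC)).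
  by rewrite (addrA _ b) cosDpihalf /GRing.scale /= expr0 expr1; ring.
pose G (t : R) : R := `|gauss_wave c m 1 0 0 t|.
have Iw : `]w - 1, w + 1[%classic w by rewrite /= in_itv /= ltrBlDr ltrDl ltr01.
have iG : mu.-integrable setT (EFin \o G) by exact: integrable_norm (iW _ _ _).
have GE w1 t : `|partial1of2 f w1 t| <= G t.
  rewrite partial1of2E; have [_ ->] := df w1 t.
  rewrite /G /gauss_wave !normrM ler_wpM2l ?mulr_ge0//.
  by rewrite mul0r addr0 cos0 normr1 cos_max.
have intf (v : R) : `]w - 1, w + 1[%classic v ->
    mu.-integrable setT (EFin \o f v).
  by move=> _; exact: iW.
have derf (v t : R) : `]w - 1, w + 1[%classic v -> setT t ->
    derivable (f ^~ t) v 1.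
  by move=> _ _; have [] := df v t.
have GE' (v t : R) : `]w - 1, w + 1[%classic v -> setT t ->
    `|partial1of2 f v t| <= G t.
  by move=> _ _; exact: GE.
have G0 (t : R) : 0 <= G t by exact: normr_ge0.
apply: DeriveDef.
  exact: (derivable_under_integral measurableT Iw intf derf G0 iG GE').
rewrite -derive1E.
rewrite (differentiation_under_integral measurableT Iw intf derf G0 iG GE').
apply: eq_Rintegral => t _.
by rewrite partial1of2E; have [_ ->] := df w t.
Qed.

(** By the two previous lemmas the integral [F] satisfies
    [F' w = - (w / (2 c)) F w], so [F w * exp (w^2 / (4 c))] is constant, and
    [F 0] is the Gaussian integral times [cos b]. *)
Lemma Rintegral_gauss_wave0 (c m w b : R) : 0 < c ->
  \int[mu]_t gauss_wave c m 0 w b t =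
  Num.sqrt (pi / c) * expR (- (w ^+ 2 / (4 * c))) * cos b.
Proof.
move=> c0; pose F (w : R) : R := \int[mu]_t gauss_wave c m 0 w b t.
pose H (w : R) : R := F w * expR (w ^+ 2 / (4 * c)).
have dF (v : R) : is_derive v 1 F (- (v / (2 * c)) * F v).
  apply: (is_derive_eq (is_derive_Rintegral_gauss_wave m b v c0)).
  exact: Rintegral_gauss_wave1.
have dH (v : R) : is_derive v 1 H 0.
  have dE : is_derive v 1 (fun v : R => expR (v ^+ 2 / (4 * c)))
      (expR (v ^+ 2 / (4 * c)) * (v / (2 * c))).
    apply: (@is_derive1_comp _ expR (fun v : R => v ^+ 2 / (4 * c))).
    apply: is_derive_eq; rewrite /GRing.scale /=; field.
    by rewrite lt0r_neq0.
  rewrite /H; apply: (is_derive_eq (is_deriveM (dF v) dE)).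
  rewrite /GRing.scale /=; field.
  by rewrite lt0r_neq0.
have := @is_derive_0_is_cst R H w 0 dH.
rewrite /H expr0n/= mul0r expR0 mulr1 => Hw.
have -> : \int[mu]_t gauss_wave c m 0 w b t = F 0 * expR (- (w ^+ 2 / (4 * c))).
  by rewrite -Hw -mulrA -expRD subrr expR0 mulr1.
rewrite -mulrA (mulrC _ (cos b)) mulrA; congr (_ * _).
rewrite /F /gauss_wave.
under eq_Rintegral do rewrite expr0 mul1r mul0r add0r.
rewrite RintegralZr//; last exact: integrable_gauss.
by rewrite /Rintegral integral_gauss.
Qed.

End gauss_fourier.

(** * Schwartz functions on the plane and Fubini *)

Section schwartz_criterion.
Context {R : realType}.

(** A derivative along a coordinate axis is a one-variable derivative: the two
    difference quotients are the same function of the increment. *)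
Lemma is_derive_axis (F : R * R -> R) (b : bool) (x : R * R) (d : R) :
  is_derive (if b then x.2 else x.1) 1
    (fun s => F (if b then (x.1, s) else (s, x.2))) d ->
  is_derive x (axis R b) F d.
Proof.
set phi := fun s => F _; set y := (if b then _ else _) => -[dphi phiE].
have E : (fun h : R => h^-1 *: ((F \o shift x) (h *: axis R b) - F x)) =
         (fun h : R => h^-1 *: ((phi \o shift y) (h *: 1) - phi y)).
  apply/funext => h; rewrite /phi /y /axis /=; case: b {phi y dphi phiE} => /=;
    congr (_ *: (F _ - F _)); case: x => x1 x2 //;
    by congr (_, _); rewrite /= scaler0 add0r.
by split; rewrite /derivable /derive E.
Qed.

(** A class of functions that is stable under partial derivatives and whose
    members decay faster than any monomial consists of Schwartz functions: all
    iterated derivatives stay in the class. *)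
Lemma schwartz_of_stable (P : (R * R -> R) -> Prop) (f : R * R -> R[i]) :
  (forall g b, P g ->
    exists2 dg, P dg & forall x, is_derive x (axis R b) g (dg x)) ->
  (forall g j k, P g ->
    exists M, forall x : R * R, `|x.1 ^+ j * x.2 ^+ k * g x| <= M) ->
  P (fun x => complex.Re (f x)) -> P (fun x => complex.Im (f x)) -> schwartz f.
Proof.
move=> Pder Pbnd PRe PIm.
have Ppd g w : P g -> P (pderiv w g).
  move=> Pg; elim: w => [|b w IHw]//=.
  have [dg Pdg gE] := Pder _ b IHw.
  rewrite (_ : (fun x => _) = dg)//.
  by apply/funext => x; have [_ ->] := gE x.
split=> [w b x|a b w].
  have [? _ dRe] := Pder _ b (Ppd _ w PRe).
  have [? _ dIm] := Pder _ b (Ppd _ w PIm).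
  by have [? _] := dRe x; have [? _] := dIm x.
have [M MRe] := Pbnd _ a b (Ppd _ w PRe).
have [N NIm] := Pbnd _ a b (Ppd _ w PIm).
exists (M + N) => _ [x _ <-]; rewrite /seminorm_fun /cpderiv /=.
set u := pderiv w _ x; set v := pderiv w _ x.
have uv : Num.sqrt (u ^+ 2 + v ^+ 2) <= `|u| + `|v|.
  rewrite -[leRHS]ger0_norm ?addr_ge0// -sqrtr_sqr ler_wsqrtr//.
  by rewrite sqrrD !real_normK ?num_real// lerD2r lerDl mulrn_wge0// mulr_ge0.
rewrite (le_trans (ler_wpM2l _ uv))// mulrDr -!normrM.
by rewrite lerD// ?MRe ?NIm.
Qed.

End schwartz_criterion.

Section gauss_tensor.
Context {R : realType}.
Implicit Types (c : R) (m : R * R) (f : R * R -> R).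

(** Separated variables reduce partial derivatives and decay to the
    one-dimensional class. *)
Inductive gauss_tensor c m : (R * R -> R) -> Prop :=
| gauss_tensorM (f g : R -> R) : gauss_trig c m.1 f -> gauss_trig c m.2 g ->
    gauss_tensor c m (fun x => f x.1 * g x.2)
| gauss_tensorD f g : gauss_tensor c m f -> gauss_tensor c m g ->
    gauss_tensor c m (fun x => f x + g x).

Lemma gauss_tensor_derive c m f b : gauss_tensor c m f ->
  exists2 df, gauss_tensor c m df & forall x, is_derive x (axis R b) f (df x).
Proof.
elim=> [{}f g tf tg|{}f g _ [df tf fE] _ [dg tg gE]]; last first.
  exists (fun x => df x + dg x); first exact: gauss_tensorD.
  by move=> x; apply: is_deriveD.
have [df tdf fE] := gauss_trig_derive tf.
have [dg tdg gE] := gauss_trig_derive tg.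
case: b.
- exists (fun x => f x.1 * dg x.2); first exact: gauss_tensorM.
  move=> x; apply: is_derive_axis => /=.
  exact: is_deriveZ.
- exists (fun x => df x.1 * g x.2); first exact: gauss_tensorM.
  move=> x; apply: is_derive_axis => /=.
  under eq_fun do rewrite mulrC.
  by rewrite mulrC; exact: is_deriveZ.
Qed.

Lemma gauss_tensor_bounded c m f j k : 0 < c -> gauss_tensor c m f ->
  exists M, forall x : R * R, `|x.1 ^+ j * x.2 ^+ k * f x| <= M.
Proof.
move=> c0; elim=> [{}f g tf tg|{}f g _ [M fM] _ [N gN]]; last first.
  by exists (M + N) => x; rewrite mulrDr (le_trans (ler_normD _ _))// lerD.
have [M fM] := gauss_trig_bounded c0 (gauss_trigMXn j tf).
have [N gN] := gauss_trig_bounded c0 (gauss_trigMXn k tg).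
by exists (M * N) => x; rewrite mulrACA normrM ler_pM.
Qed.

Lemma gauss_tensor_schwartz c m (f : R * R -> R[i]) : 0 < c ->
  gauss_tensor c m (fun x => complex.Re (f x)) ->
  gauss_tensor c m (fun x => complex.Im (f x)) -> schwartz f.
Proof.
move=> c0; apply: schwartz_of_stable => [g b|g j k].
  exact: gauss_tensor_derive.
exact: gauss_tensor_bounded.
Qed.

Notation mu := (@lebesgue_measure R).

Lemma Rintegral_prodM (f g : R -> R) :
  mu.-integrable setT (EFin \o f) -> mu.-integrable setT (EFin \o g) ->
  (mu \x mu)%E.-integrable setT (EFin \o (fun x => f x.1 * g x.2)) /\
  \int[(mu \x mu)%E]_x (f x.1 * g x.2) = (\int[mu]_t f t) * (\int[mu]_t g t).
Proof.
move=> fi gi.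
have mf : measurable_fun setT f.
  by apply/measurable_EFinP; exact: measurable_int fi.
have mg : measurable_fun setT g.
  by apply/measurable_EFinP; exact: measurable_int gi.
have mfg : measurable_fun setT (fun x : R * R => f x.1 * g x.2).
  by apply: measurable_funM; exact: measurableT_comp.
have ifg : (mu \x mu)%E.-integrable setT (EFin \o (fun x => f x.1 * g x.2)).
  apply/integrable12ltyP; first exact/measurable_EFinP.
  have E x : (\int[mu]_y `|(f x * g y)%:E|)%E =
      ((\int[mu]_y `|g y|)%:E * `|f x|%:E)%E.
    rewrite /Rintegral fineK; last exact/integrable_fin_num/integrable_norm.
    rewrite muleC -integralZl//; last exact: integrable_norm.
    by apply: eq_integral => y _; rewrite /= normrM.
  under eq_integral do rewrite E.
  rewrite integralZl//; last exact: integrable_norm.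
  rewrite -(fineK (integrable_fin_num _ (integrable_norm fi)))//.
  by rewrite -EFinM ltry.
split => //.
have E x : (\int[mu]_y (f x * g y)%:E)%E = ((\int[mu]_y g y)%:E * (f x)%:E)%E.
  rewrite /Rintegral fineK; last exact: integrable_fin_num.
  by rewrite muleC -integralZl//; apply: eq_integral => y _; rewrite EFinM.
rewrite /Rintegral -integral12_prod_meas1//=.
under eq_integral do rewrite [fubini_F _ _ _]E.
rewrite integralZl// fineM//; last exact: integrable_fin_num.
exact: mulrC.
Qed.

End gauss_tensor.

(** * Modulated Gaussians on the plane *)

Section cexp_lemmas.
Context {R : realType}.

Lemma cexp_imag (x : R) : cexp ('i%C * x%:C) = cos x +i* sin x.
Proof. by rewrite /cexp; simpc; rewrite /= expR0; simpc. Qed.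

Lemma cexp_imagN (x : R) : cexp (- 'i%C * x%:C) = cexp ('i%C * (- x)%:C).
Proof. by congr cexp; simpc. Qed.

Lemma cexp_imagD (x y : R) :
  cexp ('i%C * (x + y)%:C) = cexp ('i%C * x%:C) * cexp ('i%C * y%:C).
Proof. by rewrite !cexp_imag cosD sinD; simpc; congr (_ +i* _); ring. Qed.

Lemma conj_cexp_imag (x : R) :
  (cexp ('i%C * x%:C))^*%C = cexp ('i%C * (- x)%:C).
Proof. by rewrite !cexp_imag cosN sinN. Qed.

Lemma conjcM (z w : R[i]) : (z * w)^*%C = z^*%C * w^*%C.
Proof. exact: rmorphM. Qed.

Lemma real_complexM (x y : R) : (x * y)%:C = x%:C * y%:C.
Proof. exact: rmorphM. Qed.

End cexp_lemmas.

Section gauss_plane.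
Context {R : realType}.
Implicit Types (a c : R) (m y k : R * R).

(** The Schwartz function paired with [T] has [y = - q]; the integrand of its
    inverse Fourier transform at [x] has [y = x - q]. *)
Definition gauss_plane a c m y k : R[i] :=
  (a * (expR (- (c * (k.1 - m.1) ^+ 2)) * expR (- (c * (k.2 - m.2) ^+ 2))))%:C
  * cexp ('i%C * (dot k y)%:C).

Let cw c (m y : R) := gauss_wave c m 0 y (y * m).
Let sw c (m y : R) := gauss_wave c m 0 y (y * m - pi / 2).

Let cwE c (m y t : R) : cw c m y t = expR (- (c * (t - m) ^+ 2)) * cos (t * y).
Proof.
by rewrite /cw /gauss_wave expr0 mul1r; congr (_ * cos _); ring.
Qed.

Let swE c (m y t : R) : sw c m y t = expR (- (c * (t - m) ^+ 2)) * sin (t * y).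
Proof.
rewrite /sw /gauss_wave expr0 mul1r addrA cosBpihalf; congr (_ * sin _); ring.
Qed.

(** The addition formulas separate the variables of the plane wave, which makes
    both parts sums of tensor products. *)
Lemma Re_gauss_plane a c m y k : complex.Re (gauss_plane a c m y k) =
  a * cw c m.1 y.1 k.1 * cw c m.2 y.2 k.2
  + - a * sw c m.1 y.1 k.1 * sw c m.2 y.2 k.2.
Proof.
rewrite /gauss_plane cexp_imag /dot cosD !cwE !swE; simpc => /=; ring.
Qed.

Lemma Im_gauss_plane a c m y k : complex.Im (gauss_plane a c m y k) =
  a * sw c m.1 y.1 k.1 * cw c m.2 y.2 k.2
  + a * cw c m.1 y.1 k.1 * sw c m.2 y.2 k.2.
Proof.
rewrite /gauss_plane cexp_imag /dot sinD !cwE !swE; simpc => /=; ring.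
Qed.

Let tw a c (m w b : R) : gauss_trig c m (fun t => a * gauss_wave c m 0 w b t).
Proof. by apply: gauss_trigZ; exact: gauss_trig_wave. Qed.

Lemma schwartz_gauss_plane a c m y : 0 < c -> schwartz (gauss_plane a c m y).
Proof.
move=> c0; apply: (gauss_tensor_schwartz (m := m) c0).
- under eq_fun do rewrite Re_gauss_plane.
  by apply: gauss_tensorD;
    apply: (gauss_tensorM (tw _ _ _ _ _) (gauss_trig_wave _ _ _ _ _)).
- under eq_fun do rewrite Im_gauss_plane.
  by apply: gauss_tensorD;
    apply: (gauss_tensorM (tw _ _ _ _ _) (gauss_trig_wave _ _ _ _ _)).
Qed.

(** The factor [pi / c] is the square of the one-dimensional [sqrt (pi / c)]. *)
Lemma intR2_gauss_plane a c m y : 0 < c ->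
  intR2 (gauss_plane a c m y) =
  (a * (pi / c) * expR (- (dot y y / (4 * c))))%:C * cexp ('i%C * (dot m y)%:C).
Proof.
move=> c0.
have H (a' b1 b2 : R) := @Rintegral_prodM R
  (fun t => a' * gauss_wave c m.1 0 y.1 b1 t) (gauss_wave c m.2 0 y.2 b2)
  (gauss_trig_integrable c0 (tw _ _ _ _ _))
  (gauss_trig_integrable c0 (gauss_trig_wave _ _ _ _ _)).
have I (a' b1 b2 : R) := (H a' b1 b2).1.
have K : Num.sqrt (pi / c) * Num.sqrt (pi / c) = pi / c :> R.
  by rewrite -expr2 sqr_sqrtr// divr_ge0 ?pi_ge0// ltW.
have E : expR (- (dot y y / (4 * c))) =
    expR (- (y.1 ^+ 2 / (4 * c))) * expR (- (y.2 ^+ 2 / (4 * c))) :> R.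
  by rewrite -expRD; congr expR; rewrite /dot; field; rewrite lt0r_neq0.
have V (a' b1 b2 : R) :
    \int[(lebesgue_measure \x lebesgue_measure)%E]_x
      (a' * gauss_wave c m.1 0 y.1 b1 x.1 * gauss_wave c m.2 0 y.2 b2 x.2) =
    a' * (pi / c) * expR (- (dot y y / (4 * c))) * (cos b1 * cos b2).
  rewrite (H a' b1 b2).2 RintegralZl//; last first.
    exact: gauss_trig_integrable c0 (gauss_trig_wave _ _ _ _ _).
  by rewrite !Rintegral_gauss_wave0// -[in RHS]K E; ring.
rewrite /intR2 /cintegral cexp_imag /dot cosD sinD.
simpc; congr (_ +i* _).
- under eq_Rintegral do rewrite Re_gauss_plane.
  rewrite RintegralD//; last 2 first; [exact: I|exact: I|].
  by rewrite !V !cosBpihalf !(mulrC _ m.1) !(mulrC _ m.2); ring.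
- under eq_Rintegral do rewrite Im_gauss_plane.
  rewrite RintegralD//; last 2 first; [exact: I|exact: I|].
  by rewrite !V !cosBpihalf !(mulrC _ m.1) !(mulrC _ m.2); ring.
Qed.

Lemma inv_fourier_gauss_plane (sigma : R) (q p : R * R) : 0 < sigma ->
  inv_fourier (gauss_plane (sigma / Num.sqrt pi) (sigma ^+ 2 / 2) p (- q)) =
  coherent sigma q p.
Proof.
move=> s0; have c0 : 0 < sigma ^+ 2 / 2 by rewrite divr_gt0// exprn_gt0.
have p0 : 0 < Num.sqrt pi :> R by rewrite sqrtr_gt0 pi_gt0.
apply/funext => x; rewrite /inv_fourier.
rewrite (_ : (fun k => _) =
    gauss_plane (sigma / Num.sqrt pi) (sigma ^+ 2 / 2) p (x - q)); last first.
  apply/funext => k; rewrite /gauss_plane mulrCA -cexp_imagD.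
  by congr (_ * cexp (_ * _%:C)); rewrite /dot /=; ring.
rewrite intR2_gauss_plane// /coherent mulrC [RHS]mulrC mulrAC; congr (_ * _).
rewrite -rmorphM/=; congr (_%:C); rewrite /gauss /enorm sqr_sqrtr; last first.
  by rewrite /dot addr_ge0// -expr2 sqr_ge0.
rewrite (_ : 4 * (sigma ^+ 2 / 2) = 2 * sigma ^+ 2); last by field.
rewrite mulrAC; congr (_ * _); rewrite -mulr_natr.
(* Only the positivity of [pi] matters here; abstract it so that [field] treats
   it as an atom. *)
move: p0 (pi_gt0 R); move: (@pi R) => pi0 p0 pi0_gt0.
by field; rewrite !lt0r_neq0.
Qed.

End gauss_plane.

(** * Integrals over the circle *)

Section circle.
Context {R : realType}.
Notation mu := (@lebesgue_measure R).
Notation circle := (`[0, pi *+ 2]%classic : set R).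

Lemma mu_circle : mu circle = (pi *+ 2)%:E.
Proof.
by rewrite lebesgue_measure_itv/= lte_fin mulrn_wgt0 ?pi_gt0// sube0.
Qed.

Lemma continuous_integrable_circle (f : R -> R) : continuous f ->
  mu.-integrable circle (EFin \o f).
Proof.
move=> cf; apply: continuous_compact_integrable; first exact: segment_compact.
exact: continuous_subspaceT.
Qed.

(** At [- 2 i s] the integrand of [j0] is [exp (2 s cos t)], real and at least
    [exp (- 2 |s|)]. *)
Lemma j0_gt0 (s : R) : 0 < j0 (- 2 * 'i%C * s%:C).
Proof.
pose f (t : R) : R := expR (2 * s * cos t).
have cf : continuous f.
  move=> t; apply: continuous_comp; last exact: continuous_expR.
  by apply: cvgM; [exact: cvg_cst|exact: continuous_cos].
have E t : cexp ('i%C * (- 2 * 'i%C * s%:C) * (cos t)%:C) = (f t)%:C.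
  have -> : 'i%C * (- 2 * 'i%C * s%:C) * (cos t)%:C = (2 * s * cos t)%:C.
    have -> : 'i%C * (- 2 * 'i%C * s%:C) = - ('i%C ^+ 2) * 2 * s%:C by ring.
    by rewrite sqr_i opprK mul1r !rmorphM rmorph_nat.
  by rewrite /cexp /= sin0 cos0 mulr1.
have -> : j0 (- 2 * 'i%C * s%:C) = (\int[mu]_(t in circle) f t)%:C.
  rewrite /j0 /intS1 (_ : (fun t => _) = fun t => (f t)%:C); last exact/funext.
  by rewrite /cintegral /= Rintegral_cst//= mul0r.
rewrite ltcR.
apply: (@lt_le_trans _ _ (\int[mu]_(t in circle) expR (- (2 * `|s|)))).
  rewrite Rintegral_cst//= mulr_gt0 ?expR_gt0//.
  by rewrite -[lebesgue_measure _]/(mu circle) mu_circle mulrn_wgt0 ?pi_gt0.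
apply: le_Rintegral => //.
- by apply: continuous_integrable_circle => t; exact: cvg_cst.
- exact: continuous_integrable_circle.
move=> t _; rewrite ler_expR lerNl (le_trans (ler_norm _))// normrN !normrM.
by rewrite ger0_norm// ler_piMr ?cos_max// mulr_ge0.
Qed.

(** The normalization of the minimal-uncertainty state is a positive real, so
    complex conjugation leaves it alone and it cancels in the theorem. *)
Lemma sqrtC_j0 (s : R) : exists2 r : R, 0 < r &
  sqrtC (j0 (- 2 * 'i%C * s%:C)) = r%:C.
Proof.
have s0 : 0 < sqrtC (j0 (- 2 * 'i%C * s%:C)) by rewrite sqrtC_gt0 j0_gt0.
exists (complex.Re (sqrtC (j0 (- 2 * 'i%C * s%:C)))).
  by rewrite -ltcR RRe_real ?gtr0_real.
by rewrite RRe_real ?gtr0_real.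
Qed.

(** The circle has finite measure: [|v| <= 1 + v^2] puts [L2] inside [L1], and
    continuous functions are bounded on it.  Real and imaginary parts of the
    product of [u] with a continuous complex function have the form below. *)
Lemma L2S1_integrable (u : R -> R[i]) (g h : R -> R) : L2S1 u ->
  continuous g -> continuous h ->
  mu.-integrable circle
    (EFin \o (fun t => g t * complex.Re (u t) + h t * complex.Im (u t))).
Proof.
move=> [_ [mRe mIm] u2] cg ch.
pose n2 t := Normc.normc (u t) ^+ 2.
have n2E t : n2 t = complex.Re (u t) ^+ 2 + complex.Im (u t) ^+ 2.
  by rewrite /n2; case: (u t) => x y /=; rewrite sqr_sqrtr// addr_ge0 ?sqr_ge0.
have mn2 : measurable_fun setT n2.
  rewrite (funext n2E).
  by apply: measurable_funD; exact: measurable_funX.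
have in2 : mu.-integrable circle (EFin \o n2).
  apply/integrableP; split.
    by apply/measurable_EFinP; exact: measurable_funTS.
  by under eq_integral do rewrite /= ger0_norm ?sqr_ge0//.
have bnd (v w : R -> R) : measurable_fun setT v -> continuous w ->
   (forall t, v t ^+ 2 <= n2 t) ->
   mu.-integrable circle (EFin \o (fun t => w t * v t)).
  move=> mv cw vn2.
  have iv : mu.-integrable circle (EFin \o v).
    have i1 : mu.-integrable circle (EFin \o (fun=> 1 : R)).
      by apply: continuous_integrable_circle => t; exact: cvg_cst.
    apply: le_integrable (integrableD _ i1 in2) => //.
      by apply/measurable_EFinP; exact: measurable_funTS.
    move=> t _; rewrite /= lee_fin [leRHS]ger0_norm; last first.
      by rewrite addr_ge0 ?sqr_ge0.
    rewrite (@le_trans _ _ (1 + v t ^+ 2)) ?lerD2l//.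
    have := sqr_ge0 (`|v t| - 1); rewrite sqrrB1 real_normK ?num_real//.
    have := normr_ge0 (v t); lra.
  have [M wM] : exists M, forall t, circle t -> `|w t| <= M.
    have [c _ cM] := @EVT_max R (fun t => `|w t|) 0 (pi *+ 2)
      (mulrn_wge0 _ (pi_ge0 R))
      (continuous_subspaceT (fun x => cvg_norm (cw x))).
    by exists (`|w c|) => t /cM.
  apply: le_integrable (integrableZl _ M (integrable_norm iv)) => //.
    apply/measurable_EFinP/measurable_funTS/measurable_funM => //.
    exact: continuous_measurable_fun.
  move=> t ct; rewrite /= lee_fin normrM [leRHS]normrM normr_id.
  by rewrite ler_wpM2r// (le_trans (wM _ ct))// ler_norm.
apply: (integrableD _ (bnd _ _ mRe cg _) (bnd _ _ mIm ch _)) => // t.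
- by rewrite n2E lerDl sqr_ge0.
- by rewrite n2E lerDr sqr_ge0.
Qed.

Lemma intS1Zl (a : R) (w : R -> R[i]) :
  mu.-integrable circle (EFin \o (fun t => complex.Re (w t))) ->
  mu.-integrable circle (EFin \o (fun t => complex.Im (w t))) ->
  intS1 (fun t => a%:C * w t) = a%:C * intS1 w.
Proof.
move=> iRe iIm; rewrite /intS1 /cintegral; simpc; congr (_ +i* _).
- rewrite -RintegralZl//; apply: eq_Rintegral => t _.
  by case: (w t) => x y /=; rewrite mul0r subr0.
- rewrite -RintegralZl//; apply: eq_Rintegral => t _.
  by case: (w t) => x y /=; rewrite mul0r addr0.
Qed.

End circle.

(** * The two Bargmann transforms *)

Theorem theorem3p9 (R : realType) (Omega sigma : R)
    (hOmega : 0 < Omega) (hsigma : 0 < sigma)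
    (T : distr R) (hT : HOmega Omega T)
    (Phi : R -> R[i]) (hPhi : L2S1 Phi)
    (hTPhi : eqD (fourierD T) (That Omega Phi))
    (q p : R * R) (theta : R) (hp : p = polar (enorm p) theta) :
  bargmannH2D sigma T q p =
  (expR (- (sigma ^+ 2 * Omega ^+ 2 / 2)))%:C
  * (sqrtC (j0 (- 2 * 'i%C * (sigma ^+ 2 * enorm p * Omega)%:C))
     * (sigma / Num.sqrt pi)%:C)
  * bargmannSE2 (sigma ^+ 2 * enorm p) Omega Phi q theta.
Proof.
have c0 : 0 < sigma ^+ 2 / 2 by rewrite divr_gt0// exprn_gt0.
(* The Fourier transform of the coherent state. *)
pose f := gauss_plane (sigma / Num.sqrt pi) (sigma ^+ 2 / 2) p (- q).
have -> : bargmannH2D sigma T q p =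
    (expR (sigma ^+ 2 * enorm p ^+ 2 / 2))%:C * That Omega Phi f.
  rewrite /bargmannH2D -hTPhi; last exact: schwartz_gauss_plane.
  by rewrite /fourierD inv_fourier_gauss_plane.
set P := enorm p in hp *; rewrite /bargmannSE2 /dotS1 /That /PiSE2 /u0.
have [r r0 ->] := sqrtC_j0 (sigma ^+ 2 * P * Omega).
(* Both circle integrands are real multiples of [w]. *)
pose phase t := Omega * (q.1 * cos t + q.2 * sin t).
pose weight t := expR (sigma ^+ 2 * P * Omega * cos (t - theta)).
pose w t : R[i] := ((weight t)%:C * cexp ('i%C * (phase t)%:C)) * Phi t.
have cphase : continuous phase.
  move=> t; apply: cvgM; first exact: cvg_cst.
  by apply: cvgD; apply: cvgM; (exact: cvg_cst || exact: continuous_cos ||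
    exact: continuous_sin).
have cweight : continuous weight.
  move=> t; apply: continuous_comp; last exact: continuous_expR.
  apply: cvgM; first exact: cvg_cst.
  apply: continuous_comp; last exact: continuous_cos.
  by apply: cvgB; [exact: cvg_id|exact: cvg_cst].
pose g t := weight t * cos (phase t).
pose h t := weight t * sin (phase t).
have cg : continuous g.
  move=> t; apply: cvgM; first exact: cweight.
  by apply: continuous_comp; [exact: cphase|exact: continuous_cos].
have ch : continuous h.
  move=> t; apply: cvgM; first exact: cweight.
  by apply: continuous_comp; [exact: cphase|exact: continuous_sin].
have iRe : lebesgue_measure.-integrable `[0, pi *+ 2]
    (EFin \o (fun t => complex.Re (w t))).
  rewrite (_ : (fun t => _) = fun t =>
      g t * complex.Re (Phi t) + (- h) t * complex.Im (Phi t)); last first.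
    apply/funext => t; rewrite /w cexp_imag.
    by case: (Phi t) => x y; simpc; rewrite /= /g /h; ring.
  by apply: L2S1_integrable => // t; apply: cvgN; exact: ch.
have iIm : lebesgue_measure.-integrable `[0, pi *+ 2]
    (EFin \o (fun t => complex.Im (w t))).
  rewrite (_ : (fun t => _) = fun t =>
      h t * complex.Re (Phi t) + g t * complex.Im (Phi t)); last first.
    apply/funext => t; rewrite /w cexp_imag.
    by case: (Phi t) => x y; simpc; rewrite /= /g /h; ring.
  exact: L2S1_integrable.
rewrite (_ : (fun t => _ * (f _)^*%C) = fun t =>
  (sigma / Num.sqrt pi * expR (- (sigma ^+ 2 / 2 * (Omega ^+ 2 + P ^+ 2))))%:C
  * w t); last first.
  apply/funext => t; rewrite /f /gauss_plane conjcM conj_cexp_imag conjc_real.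
  have -> : - dot (polar Omega t) (- q) = phase t.
    by rewrite /dot /phase /=; ring.
  rewrite -expRD (_ : expR _ =
    expR (- (sigma ^+ 2 / 2 * (Omega ^+ 2 + P ^+ 2))) * weight t); last first.
    rewrite -expRD hp; congr expR; rewrite /= cosB.
    (* Write the squared radii with [cos^2 + sin^2], so that the identity of the
       exponents becomes polynomial. *)
    rewrite -[in RHS](mulr1 (Omega ^+ 2)) -[in RHS](mulr1 (P ^+ 2)).
    rewrite -[X in _ * (Omega ^+ 2 * X + _)](cos2Dsin2 t).
    rewrite -[X in _ * (_ + P ^+ 2 * X)](cos2Dsin2 theta).
    by field.
  by rewrite /w !real_complexM; ring.
rewrite [X in _ = _ * intS1 X](_ : _ = fun t => r^-1%:C * w t); last first.
  apply/funext => t; rewrite cexp_imagN conjcM conj_cexp_imag opprK conjcM.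
  rewrite conjc_inv !conjc_real (fmorphV (real_complex R)) /w /weight /phase.
  by ring.
rewrite !intS1Zl// [LHS]mulrA [RHS]mulrA; congr (_ * _).
rewrite -!real_complexM; congr (_%:C).
rewrite (_ : - (sigma ^+ 2 * Omega ^+ 2 / 2) =
  sigma ^+ 2 * P ^+ 2 / 2 + - (sigma ^+ 2 / 2 * (Omega ^+ 2 + P ^+ 2))).
  by rewrite expRD; field; rewrite !lt0r_neq0// sqrtr_gt0 pi_gt0.
by field.
Qed.
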